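(* Let $(U^{(n)},M^{(n)})_{n\ge 0}$, with $U^{(n)}=(U^{(n)}_1,U^{(n)}_2)$ and $M^{(n)}=(M^{(n)}_1,M^{(n)}_2)$, be a numerical solution produced by Scheme 3 (as defined in the context) under the discrete periodic boundary conditions. Then for each $n=1,2,\ldots$, $$\sum_{j=0}^{\mathcal J-1}\sum_{k=0}^{\mathcal K-1} H^{(n+\frac12)}_{k,j}\,\Delta x\,\Delta y=\sum_{j=0}^{\mathcal J-1}\sum_{k=0}^{\mathcal K-1} H^{(\frac12)}_{k,j}\,\Delta x\,\Delta y ,$$ where $$H^{(n+\frac12)}_{k,j}=\tfrac14\Big(M^{(n+1)}_{1;k,j}U^{(n+1)}_{1;k,j}+M^{(n)}_{1;k,j}U^{(n)}_{1;k,j}+M^{(n+1)}_{2;k,j}U^{(n+1)}_{2;k,j}+M^{(n)}_{2;k,j}U^{(n)}_{2;k,j}\Big).$$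
   Context: Fix $\alpha>0$, a time step $\Delta t>0$, and integers $\mathcal K,\mathcal J\ge 1$; put $\Delta x=2/\mathcal K$, $\Delta y=2/\mathcal J$. Grid functions are real arrays $f=(f_{k,j})$, $0\le k\le\mathcal K-1$, $0\le j\le\mathcal J-1$, where $k$ is the index in the $x$ direction and $j$ the index in the $y$ direction; they are extended periodically ($k$ modulo $\mathcal K$, $j$ modulo $\mathcal J$; these are the discrete periodic boundary conditions). Products of grid functions are entrywise. The discrete operators are $$\delta_k^{<1>}f_{k,j}=\frac{f_{k+1,j}-f_{k-1,j}}{2\Delta x},\quad \delta_j^{<1>}f_{k,j}=\frac{f_{k,j+1}-f_{k,j-1}}{2\Delta y},$$ $$\delta_{kk}^{<2>}f_{k,j}=\frac{f_{k+1,j}-2f_{k,j}+f_{k-1,j}}{\Delta x^2},\quad \delta_{jj}^{<2>}f_{k,j}=\frac{f_{k,j+1}-2f_{k,j}+f_{k,j-1}}{\Delta y^2}.$$ At each time level $n$ the discrete velocity $U^{(n)}_i$ and momentum $M^{(n)}_i$ ($i=1,2$) are grid functions related by $M^{(n)}_{i;k,j}=(1-\alpha^2\delta_{kk}^{<2>}-\alpha^2\delta_{jj}^{<2>})U^{(n)}_{i;k,j}$. Scheme 3 is a two-step linearly implicit scheme: the levels $n=0$ and $n=1$ are starting data, and, writing $V_{i}=\frac12\big(U^{(n+1)}_{i}+U^{(n-1)}_{i}\big)$ for $i=1,2$, for all $n\ge1$ and all $k,j$ $$\frac{M^{(n+1)}_{1;k,j}-M^{(n-1)}_{1;k,j}}{2\Delta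 t}=-\Big[M^{(n)}_{1;k,j}\,\delta_k^{<1>}V_{1;k,j}+M^{(n)}_{2;k,j}\,\delta_k^{<1>}V_{2;k,j}+\delta_k^{<1>}(M^{(n)}_{1;k,j}V_{1;k,j})+\delta_j^{<1>}(M^{(n)}_{1;k,j}V_{2;k,j})\Big],$$ $$\frac{M^{(n+1)}_{2;k,j}-M^{(n-1)}_{2;k,j}}{2\Delta t}=-\Big[M^{(n)}_{1;k,j}\,\delta_j^{<1>}V_{1;k,j}+M^{(n)}_{2;k,j}\,\delta_j^{<1>}V_{2;k,j}+\delta_k^{<1>}(M^{(n)}_{2;k,j}V_{1;k,j})+\delta_j^{<1>}(M^{(n)}_{2;k,j}V_{2;k,j})\Big].$$ *)

(* Defs.v *)
From mathcomp Require Import all_boot all_order all_algebra.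
From mathcomp Require Import reals.

Set Implicit Arguments.
Unset Strict Implicit.
Unset Printing Implicit Defensive.

Import GRing.Theory Num.Theory.
Local Open Scope ring_scope.

(* Mesh size of a periodic direction of length 2 cut into [n] cells:
   dx = mesh R K and dy = mesh R J. *)
Definition mesh (R : realType) (n : nat) : R := 2 / n%:R.

(* [f k j]: the first index is the x direction, the second the y direction.
   Periodic extension is encoded by the cyclic successor [ordS] and cyclic
   predecessor [ord_pred] of ordinals, i.e. k+1 and k-1 modulo K. *)
Definition grid (R : realType) (K J : nat) : Type := 'I_K -> 'I_J -> R.

Section Scheme.
Variables (R : realType) (K J : nat).
Implicit Types f g : grid R K J.

Local Notation dx := (mesh R K).
Local Notation dy := (mesh R J).

Definition gmul f g : grid R K J := fun k j => f k j * g k j.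

Definition delta1x f : grid R K J :=
  fun k j => (f (ordS k) j - f (ord_pred k) j) / (2 * dx).

Definition delta1y f : grid R K J :=
  fun k j => (f k (ordS j) - f k (ord_pred j)) / (2 * dy).

Definition delta2x f : grid R K J :=
  fun k j => (f (ordS k) j - 2 * f k j + f (ord_pred k) j) / dx ^+ 2.

Definition delta2y f : grid R K J :=
  fun k j => (f k (ordS j) - 2 * f k j + f k (ord_pred j)) / dy ^+ 2.

Definition helmholtz (alpha : R) f : grid R K J :=
  fun k j => f k j - alpha ^+ 2 * delta2x f k j - alpha ^+ 2 * delta2y f k j.

(* [midpoint U n] is V = (U^(n+1) + U^(n-1)) / 2; only used for n >= 1, since
   [n.-1] truncates at 0. *)
Definition midpoint (U : nat -> grid R K J) (n : nat) : grid R K J :=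
  fun k j => (U n.+1 k j + U n.-1 k j) / 2.

Definition scheme3_solution (alpha dt : R)
    (U1 U2 M1 M2 : nat -> grid R K J) : Prop :=
  [/\ forall n k j, M1 n k j = helmholtz alpha (U1 n) k j,
      forall n k j, M2 n k j = helmholtz alpha (U2 n) k j,
      forall n k j, (1 <= n)%N ->
        let V1 := midpoint U1 n in
        let V2 := midpoint U2 n in
        (M1 n.+1 k j - M1 n.-1 k j) / (2 * dt) =
        - (M1 n k j * delta1x V1 k j + M2 n k j * delta1x V2 k j
           + delta1x (gmul (M1 n) V1) k j + delta1y (gmul (M1 n) V2) k j)
    & forall n k j, (1 <= n)%N ->
        let V1 := midpoint U1 n in
        let V2 := midpoint U2 n in
        (M2 n.+1 k j - M2 n.-1 k j) / (2 * dt) =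
        - (M1 n k j * delta1y V1 k j + M2 n k j * delta1y V2 k j
           + delta1x (gmul (M2 n) V1) k j + delta1y (gmul (M2 n) V2) k j)].

(* [Hhalf U1 U2 M1 M2 n] is H^(n+1/2). *)
Definition Hhalf (U1 U2 M1 M2 : nat -> grid R K J) (n : nat) : grid R K J :=
  fun k j => 1 / 4 * (M1 n.+1 k j * U1 n.+1 k j + M1 n k j * U1 n k j
                      + M2 n.+1 k j * U2 n.+1 k j + M2 n k j * U2 n k j).

End Scheme.

(* Main.v *)
Require Import Defs.
From mathcomp Require Import all_boot all_order all_algebra.
From mathcomp Require Import reals.
From mathcomp Require Import ring.

Import GRing.Theory Num.Theory.
Local Open Scope ring_scope.

(** Put E_n = <M1^n, U1^n> + <M2^n, U2^n>.  The Helmholtz operator is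
    symmetric, so E_(n+1) - E_(n-1) = <M^(n+1) - M^(n-1), U^(n+1) + U^(n-1)>.
    Testing the scheme against V turns this into a sum of terms
    (M_i V_l) (delta V_i) + delta (M_i V_l) V_i, each of which sums to zero
    because the centred differences are skew-symmetric.  Hence
    E_(n+1) = E_(n-1), and E_(n+1) + E_n does not depend on n. *)

Definition gsum {R : realType} {K J : nat} (f : grid R K J) : R :=
  \sum_(j < J) \sum_(k < K) f k j.

Section PeriodicSums.
Context {R : realType} {K J : nat}.
Implicit Types (f g : grid R K J) (c : R).

Lemma eq_gsum f g : (forall k j, f k j = g k j) -> gsum f = gsum g.
Proof. by move=> fg; apply: eq_bigr => j _; apply: eq_bigr => k _. Qed.

Lemma gsumD f g : gsum (fun k j => f k j + g k j) = gsum f + gsum g.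
Proof. by rewrite -big_split; apply: eq_bigr => j _; rewrite big_split. Qed.

Lemma gsumZ c f : gsum (fun k j => c * f k j) = c * gsum f.
Proof. by rewrite mulr_sumr; apply: eq_bigr => j _; rewrite mulr_sumr. Qed.

(** The predecessor is cyclic, hence a permutation of the indices, so no boundary terms survive. *)
Lemma sum_cyclic_telescope n (a : 'I_n -> R) :
  \sum_i (a i - a (ord_pred i)) = 0.
Proof.
by rewrite sumrB [X in X - _](reindex_inj (@ord_pred_inj n)) subrr.
Qed.

Lemma gsum_telescope_x f :
  gsum (fun k j => f k j - f (ord_pred k) j) = 0.
Proof. by apply: big1 => j _; apply: (sum_cyclic_telescope K (f^~ j)). Qed.

Lemma gsum_telescope_y f :
  gsum (fun k j => f k j - f k (ord_pred j)) = 0.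
Proof.
rewrite /gsum exchange_big; apply: big1 => k _.
exact: (sum_cyclic_telescope J (f k)).
Qed.

(** Discrete product rule: the summand is the backward difference of the flux (f_(k+1) g_k + f_k
    g_(k+1)) / (2 dx). *)
Lemma delta1x_skew f g :
  gsum (fun k j => delta1x f k j * g k j + f k j * delta1x g k j) = 0.
Proof.
rewrite -(gsum_telescope_x (fun k j =>
  (f (ordS k) j * g k j + f k j * g (ordS k) j) / (2 * mesh R K))).
by apply: eq_gsum => k j; rewrite /delta1x ord_predK; ring.
Qed.

Lemma delta1y_skew f g :
  gsum (fun k j => delta1y f k j * g k j + f k j * delta1y g k j) = 0.
Proof.
rewrite -(gsum_telescope_y (fun k j =>
  (f k (ordS j) * g k j + f k j * g k (ordS j)) / (2 * mesh R J))).
by apply: eq_gsum => k j; rewrite /delta1y ord_predK; ring.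
Qed.

(** Discrete Green identity: the diagonal terms -2 f g cancel, and what remains is a backward
    difference of a Wronskian-like flux. *)
Lemma delta2x_sym f g :
  gsum (fun k j => delta2x f k j * g k j - f k j * delta2x g k j) = 0.
Proof.
rewrite -(gsum_telescope_x (fun k j =>
  (f (ordS k) j * g k j - f k j * g (ordS k) j) / mesh R K ^+ 2)).
by apply: eq_gsum => k j; rewrite /delta2x ord_predK; ring.
Qed.

Lemma delta2y_sym f g :
  gsum (fun k j => delta2y f k j * g k j - f k j * delta2y g k j) = 0.
Proof.
rewrite -(gsum_telescope_y (fun k j =>
  (f k (ordS j) * g k j - f k j * g k (ordS j)) / mesh R J ^+ 2)).
by apply: eq_gsum => k j; rewrite /delta2y ord_predK; ring.
Qed.

Lemma helmholtz_sym (alpha : R) f g :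
  gsum (fun k j => helmholtz alpha f k j * g k j
                   - f k j * helmholtz alpha g k j) = 0.
Proof.
rewrite -[RHS](mulr0 (- alpha ^+ 2)) -[X in _ * X]addr0.
rewrite -[X in X + _](delta2x_sym f g) -[X in _ + X](delta2y_sym f g).
rewrite -gsumD -gsumZ.
by apply: eq_gsum => k j; rewrite /helmholtz; ring.
Qed.

End PeriodicSums.

(** Twice the kinetic energy of one time level, without the cell area. *)
Definition energy {R : realType} {K J : nat}
    (U1 U2 M1 M2 : nat -> grid R K J) (n : nat) : R :=
  gsum (fun k j => M1 n k j * U1 n k j + M2 n k j * U2 n k j).

Section Conservation.
Context {R : realType} {K J : nat} {alpha dt : R}.
Context {U1 U2 M1 M2 : nat -> grid R K J}.
Context (dt_neq0 : dt != 0)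
        (sol : scheme3_solution alpha dt U1 U2 M1 M2).

Local Notation E := (energy U1 U2 M1 M2).

Lemma energy_two_step n : E n.+2 = E n.
Proof.
have [hM1 hM2 s1 s2] := sol.
have step a b c : (a - b) / (2 * dt) = c -> a = b + 2 * dt * c.
  by move=> <-; field.
pose V1 := midpoint U1 n.+1; pose V2 := midpoint U2 n.+1.
(* The brackets of the two equations, tested with V1 and V2 and regrouped by flux. The cross terms
   pair across equations: M2 (delta_x V2) V1 from the first meets delta_x (M2 V1) V2 from the
   second. *)
pose skew := gsum (fun k j =>
  (delta1x (gmul (M1 n.+1) V1) k j * V1 k j
     + gmul (M1 n.+1) V1 k j * delta1x V1 k j)
  + (delta1y (gmul (M1 n.+1) V2) k j * V1 k j
     + gmul (M1 n.+1) V2 k j * delta1y V1 k j)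
  + (delta1x (gmul (M2 n.+1) V1) k j * V2 k j
     + gmul (M2 n.+1) V1 k j * delta1x V2 k j)
  + (delta1y (gmul (M2 n.+1) V2) k j * V2 k j
     + gmul (M2 n.+1) V2 k j * delta1y V2 k j)).
have skew0 : skew = 0.
  rewrite /skew gsumD [X in X + _]gsumD [X in X + _ + _]gsumD.
  by rewrite !(delta1x_skew, delta1y_skew) !addr0.
(* The cross terms between the levels n and n+2. *)
pose sym := gsum (fun k j =>
  (helmholtz alpha (U1 n) k j * U1 n.+2 k j
     - U1 n k j * helmholtz alpha (U1 n.+2) k j)
  + (helmholtz alpha (U2 n) k j * U2 n.+2 k j
     - U2 n k j * helmholtz alpha (U2 n.+2) k j)).
have sym0 : sym = 0 by rewrite /sym gsumD !helmholtz_sym addr0.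
(* The goal becomes E_(n+2) = E_n + sym - 4 dt skew, which holds pointwise. The 4 is 2 from the time
   quotient times 2 from U^(n+2) + U^n = 2 V. *)
rewrite -[RHS]addr0 -[X in _ + X]addr0 -[X in _ + (X + _)]sym0.
rewrite -[X in _ + (_ + X)](mulr0 (- (4 * dt))) -skew0.
rewrite /E /sym /skew -gsumZ -!gsumD; apply: eq_gsum => k j.
have e1 := step _ _ _ (s1 n.+1 k j isT).
have e2 := step _ _ _ (s2 n.+1 k j isT).
rewrite -!hM1 -!hM2.
move: e1 e2; rewrite /= -/V1 -/V2.
have -> : U1 n.+2 k j = 2 * V1 k j - U1 n k j by rewrite /V1 /midpoint /=; field.
have -> : U2 n.+2 k j = 2 * V2 k j - U2 n k j by rewrite /V2 /midpoint /=; field.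
(* Only the products at (k, j) are unfolded; those under a difference operator stay opaque, so
   [ring] sees each difference as an atom. *)
move=> -> ->; rewrite [gmul (M1 _) V1 k j]/gmul [gmul (M1 _) V2 k j]/gmul.
by rewrite [gmul (M2 _) V1 k j]/gmul [gmul (M2 _) V2 k j]/gmul; ring.
Qed.

Lemma energy_pair n : E n.+1 + E n = E 1 + E 0.
Proof. by elim: n => // n IHn; rewrite energy_two_step addrC. Qed.

End Conservation.

Lemma sum_Hhalf (R : realType) (K J : nat) (U1 U2 M1 M2 : nat -> grid R K J) n :
  \sum_(j < J) \sum_(k < K) Hhalf U1 U2 M1 M2 n k j * mesh R K * mesh R J =
  mesh R K * mesh R J / 4
    * (energy U1 U2 M1 M2 n.+1 + energy U1 U2 M1 M2 n).
Proof.
rewrite /energy -gsumD -gsumZ; apply: eq_gsum => k j.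
by rewrite /Hhalf; field.
Qed.

Theorem theorem5 (R : realType) (alpha dt : R) (K J : nat)
    (U1 U2 M1 M2 : nat -> grid R K J)
    (halpha : 0 < alpha) (hdt : 0 < dt) (hK : (1 <= K)%N) (hJ : (1 <= J)%N)
    (hsol : scheme3_solution alpha dt U1 U2 M1 M2) :
  forall n : nat, (1 <= n)%N ->
    \sum_(j < J) \sum_(k < K) Hhalf U1 U2 M1 M2 n k j * mesh R K * mesh R J =
    \sum_(j < J) \sum_(k < K) Hhalf U1 U2 M1 M2 0 k j * mesh R K * mesh R J.
Proof.
by move=> n _; rewrite !sum_Hhalf (energy_pair (lt0r_neq0 hdt) hsol).
Qed.
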